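(* Let $f(x)\in\mathbb{Z}[x]$ be a univariate polynomial and $p$ a prime. Fix $i\in[n]$ and fix $\bar{\alpha}\in\mathbb{Z}_p$ such that $v_p(\bar{\alpha}-\alpha_i)>\Delta$. Then: (1) $v_p(g_j(\bar{\alpha}))=v_p(g_j(\alpha_i))$ for all $j\in[m]$; (2) $v_p(f_i(\bar{\alpha}))=v_p(f_i(\alpha_i))$.
   Context: $\mathbb{Z}_p$ is the ring of $p$-adic integers, $v_p$ the $p$-adic valuation (with $v_p(0)=\infty$), and $[n]=\{1,\ldots,n\}$. The polynomial $f$ is viewed in $\mathbb{Z}_p[x]$, with factorization into coprime irreducible factors over $\mathbb{Z}_p$ (up to a unit of $\mathbb{Z}_p$) $f(x)=\prod_{i\in[n]}(x-\alpha_i)^{e_i}\cdot\prod_{j=1}^m g_j(x)^{t_j}$, where $\alpha_1,\dots,\alpha_n$ are the distinct $\mathbb{Z}_p$-roots of $f$, $e_i$ is the multiplicity of $\alpha_i$, and each $g_j\in\mathbb{Z}_p[x]$ is irreducible over $\mathbb{Z}_p$, has no $\mathbb{Z}_p$-root and has multiplicity $t_j$ in $f$. For $i\in[n]$, $f_i(x):=f(x)/(x-\alpha_i)^{e_i}$. The radical is $\mathrm{rad}(f):=\prod_{i=1}^n(x-\alpha_i)\cdot\prod_{j=1}^m g_j(x)$. The discriminant of a polynomial $h$ of degree $m$ over a field, with leading coefficient $h_m$ and roots $r_1,\dots,r_m$ in an algebraic closure, is $D(h):=h_m^{2m-1}\prod_{1\le i<j\le m}(r_i-r_j)^2$, and the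 discriminant of a linear polynomial is defined to be $1$. $\Delta:=v_p(D(\mathrm{rad}(f)))$. *)

(* Defs.v *)
From HB Require Import structures.
From mathcomp Require Import all_boot all_order all_algebra.
From mathcomp Require Import boolp classical_sets constructive_ereal.

Set Implicit Arguments.
Unset Strict Implicit.
Unset Printing Implicit Defensive.

Import Order.TTheory GRing.Theory Num.Theory.
Local Open Scope ring_scope.

(** The p-adic integers are the inverse limit of the rings Z/p^k: [x k] is the
    residue of [x] modulo [p ^ k].  The condition also forces [x k < p ^ k], so
    equal p-adic integers have equal residue sequences. *)
Definition coherent (p : nat) (x : nat -> nat) : bool :=
  `[< forall k, x k = (x k.+1 %% p ^ k)%N >].

Record padic_int (p : nat) (p_pr : prime p) := PadicInt {
  residue :> nat -> nat;
  _ : coherent p residue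
}.

HB.instance Definition _ (p : nat) (p_pr : prime p) :=
  [isSub for @residue p p_pr].
HB.instance Definition _ (p : nat) (p_pr : prime p) :=
  [Choice of padic_int p_pr by <:].

Section PadicRing.
Variables (p : nat) (p_pr : prime p).
Local Notation Zp := (padic_int p_pr).
Implicit Types (x y z : Zp) (u : nat -> nat).

Lemma residueE x k : x k = (x k.+1 %% p ^ k)%N.
Proof. by case: x => x /= /asboolP. Qed.

Lemma pX_gt0 k : (0 < p ^ k)%N.
Proof. by rewrite expn_gt0 prime_gt0. Qed.

Lemma residue_mod x k : (x k %% p ^ k)%N = x k.
Proof. by rewrite residueE modn_mod. Qed.

Lemma residue_le x k l : (k <= l)%N -> x k = (x l %% p ^ k)%N.
Proof.
elim: l => [|l IHl]; first by rewrite leqn0 => /eqP ->; rewrite residue_mod.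
rewrite leq_eqVlt ltnS => /predU1P[->|kl]; first by rewrite residue_mod.
by rewrite IHl // (residueE x l) modn_dvdm // dvdn_exp2l.
Qed.

Lemma padic_eqP x y : (forall k, x k = y k) -> x = y.
Proof. by move=> xy; apply/val_inj/funext. Qed.

Lemma coherent_mod u :
  (forall k, u k.+1 = u k %[mod p ^ k]) -> coherent p (fun k => u k %% p ^ k)%N.
Proof.
move=> u_coh; apply/asboolP => k.
by rewrite modn_dvdm ?u_coh // dvdn_exp2l.
Qed.

Definition of_residues u uP : Zp := PadicInt p_pr (@coherent_mod u uP).

Fact const_coherent n k : n = n %[mod p ^ k].
Proof. by []. Qed.

Fact add_coherent x y k : (x k.+1 + y k.+1)%N = (x k + y k)%N %[mod p ^ k].
Proof. by rewrite [x k]residueE [y k]residueE modnDm. Qed.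

Fact mul_coherent x y k : (x k.+1 * y k.+1)%N = (x k * y k)%N %[mod p ^ k].
Proof. by rewrite [x k]residueE [y k]residueE modnMm. Qed.

Fact opp_coherent x k :
  (p ^ k.+1 - x k.+1)%N = (p ^ k - x k)%N %[mod p ^ k].
Proof.
have lt_x l : (x l < p ^ l)%N by rewrite residueE ltn_mod pX_gt0.
apply/eqP; rewrite -(eqn_modDr (x k.+1)) subnK ?(ltnW (lt_x _)) //.
rewrite -modnDmr -residueE subnK ?(ltnW (lt_x _)) // modnn.
by apply/eqP; rewrite expnS modnMl.
Qed.

Definition padic_nat n : Zp := of_residues (const_coherent n).
Definition padic_add x y : Zp := of_residues (add_coherent x y).
Definition padic_mul x y : Zp := of_residues (mul_coherent x y).
Definition padic_opp x : Zp := of_residues (opp_coherent x).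

Fact padic_addA : associative padic_add.
Proof. by move=> x y z; apply: padic_eqP => k /=; rewrite modnDml modnDmr addnA. Qed.

Fact padic_addC : commutative padic_add.
Proof. by move=> x y; apply: padic_eqP => k /=; rewrite addnC. Qed.

Fact padic_add0 : left_id (padic_nat 0) padic_add.
Proof. by move=> x; apply: padic_eqP => k /=; rewrite mod0n residue_mod. Qed.

Fact padic_addN : left_inverse (padic_nat 0) padic_opp padic_add.
Proof.
move=> x; apply: padic_eqP => k /=; rewrite modnDml subnK ?modnn ?mod0n //.
by rewrite residueE ltnW // ltn_mod pX_gt0.
Qed.

HB.instance Definition _ :=
  GRing.isZmodule.Build Zp padic_addA padic_addC padic_add0 padic_addN.

Fact padic_mulA : associative padic_mul.
Proof. by move=> x y z; apply: padic_eqP => k /=; rewrite modnMml modnMmr mulnA. Qed.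

Fact padic_mulC : commutative padic_mul.
Proof. by move=> x y; apply: padic_eqP => k /=; rewrite mulnC. Qed.

Fact padic_mul1 : left_id (padic_nat 1) padic_mul.
Proof. by move=> x; apply: padic_eqP => k /=; rewrite modnMml mul1n residue_mod. Qed.

Fact padic_mulDl : left_distributive padic_mul padic_add.
Proof.
by move=> x y z; apply: padic_eqP => k /=; rewrite modnMml modnDm mulnDl.
Qed.

Fact padic_oner_neq0 : padic_nat 1 != 0.
Proof.
apply/eqP => /(congr1 (fun x : Zp => x 1%N)) /=.
by rewrite expn1 mod0n modn_small ?prime_gt1.
Qed.

HB.instance Definition _ := GRing.Zmodule_isComNzRing.Build Zp
  padic_mulA padic_mulC padic_mul1 padic_mulDl padic_oner_neq0.

Definition padic_unit : {pred Zp} := fun x => `[< exists y, y * x = 1 >].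

Definition padic_inv x : Zp :=
  if pselect (exists y, y * x = 1) is left exy then sval (cid exy) else x.

Fact padic_mulVx : {in padic_unit, left_inverse 1 padic_inv *%R}.
Proof.
by move=> x /asboolP xU; rewrite /padic_inv; case: pselect => // e; case: cid.
Qed.

Fact padic_unitP x y : y * x = 1 -> padic_unit x.
Proof. by move=> yx1; apply/asboolP; exists y. Qed.

Fact padic_inv_out : {in [predC padic_unit], padic_inv =1 id}.
Proof. by move=> x /asboolPn xNU; rewrite /padic_inv; case: pselect. Qed.

HB.instance Definition _ := GRing.ComNzRing_hasMulInverse.Build Zp
  padic_mulVx padic_unitP padic_inv_out.

Lemma residue0 k : (0 : Zp) k = 0%N.
Proof. exact: mod0n. Qed.

Lemma residueM x y k : (x * y) k = (x k * y k %% p ^ k)%N.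
Proof. by []. Qed.

Lemma padic_neq0 x : x != 0 -> exists k, x k.+1 != 0%N.
Proof.
move=> x_neq0; apply: contrapT => /forallNP x0; case/eqP: x_neq0.
apply: padic_eqP => k; rewrite residue0 residueE.
by have /negP := x0 k; rewrite negbK => /eqP ->; rewrite mod0n.
Qed.

(** For [x != 0] this is the greatest [k] such that [x] vanishes modulo
    [p ^ k]. *)
Definition padic_ord x (x_neq0 : x != 0) : nat := ex_minn (padic_neq0 x_neq0).

Definition vp x : \bar int :=
  if pselect (x != 0) is left x_neq0 then (padic_ord x_neq0)%:Z%:E else +oo%E.

Lemma vp0 : vp 0 = +oo%E.
Proof. by rewrite /vp; case: pselect => // x0; exfalso; rewrite eqxx in x0. Qed.

Lemma logn_residue x k l : x k != 0%N -> (k <= l)%N -> logn p (x l) = logn p (x k).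
Proof.
move=> xk0 kl; have xl0 : x l != 0%N.
  by apply: contra_neq xk0 => xl0; rewrite (residue_le _ kl) xl0 mod0n.
have lek : (logn p (x k) < k)%N.
  by rewrite ltnNge -pfactor_dvdn ?lt0n // /dvdn residue_mod.
have dvdx j : (j <= k)%N -> (p ^ j %| x l)%N = (p ^ j %| x k)%N.
  move=> jk; rewrite (residue_le x kl) /dvdn modn_dvdm //.
  exact: dvdn_exp2l.
apply/eqP; rewrite eqn_leq; apply/andP; split.
  by rewrite leqNgt -pfactor_dvdn ?lt0n // dvdx // pfactor_dvdn ?lt0n // ltnn.
by rewrite -pfactor_dvdn ?lt0n // dvdx ?(ltnW lek) // pfactor_dvdn ?lt0n.
Qed.

Lemma vpE x k : x k != 0%N -> vp x = (logn p (x k))%:Z%:E.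
Proof.
move=> xk0; rewrite /vp; case: pselect => [x0|]; last first.
  by case; apply: contra_neq xk0 => ->; rewrite residue0.
rewrite /padic_ord; case: ex_minnP => i xi0 i_min; congr (_%:Z%:E).
case: k xk0 => [|k] xk0; first by rewrite residueE expn0 modn1 in xk0.
have ik : (i.+1 <= k.+1)%N by rewrite ltnS i_min.
rewrite (logn_residue xi0 ik).
apply/eqP; rewrite eqn_leq -pfactor_dvdn ?lt0n //; apply/andP; split.
  case: i xi0 i_min {ik} => [|i] _ i_min; first by rewrite expn0 dvd1n.
  rewrite /dvdn -residueE; apply: contraT => /i_min.
  by rewrite ltnn.
by rewrite -ltnS ltnNge -pfactor_dvdn ?lt0n // /dvdn residue_mod.
Qed.

Lemma vp_neq0 x : x != 0 -> exists2 k, x k != 0%N & vp x = (logn p (x k))%:Z%:E.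
Proof. by move=> /padic_neq0[k xk]; exists k.+1 => //; apply: vpE. Qed.

Lemma residue_mul_neq0 x y : x != 0 -> y != 0 ->
  exists k, [/\ x k != 0%N, y k != 0%N, (x * y) k != 0%N &
    logn p ((x * y)%R k) = (logn p (x k) + logn p (y k))%N].
Proof.
move=> /padic_neq0[i xi] /padic_neq0[j yj].
have neq_le z a b : (a <= b)%N -> z a != 0%N -> z b != 0%N.
  by move=> ab; apply: contra_neq => zb0; rewrite (residue_le z ab) zb0 mod0n.
pose k := (i.+1 + j.+1 + (logn p (x i.+1) + logn p (y j.+1)).+1)%N.
have ik : (i.+1 <= k)%N by rewrite /k -addnA leq_addr.
have jk : (j.+1 <= k)%N by rewrite /k addnAC leq_addl.
have xk := neq_le _ _ _ ik xi; have yk := neq_le _ _ _ jk yj.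
have lxy : logn p (x k * y k)%N = (logn p (x i.+1) + logn p (y j.+1))%N.
  by rewrite lognM ?lt0n // (logn_residue xi ik) (logn_residue yj jk).
have xyk0 : (x k * y k != 0)%N by rewrite muln_eq0 negb_or xk.
have lk : (logn p (x k * y k) < k)%N by rewrite lxy /k leq_addl.
have xyk : (x * y) k != 0%N.
  rewrite residueM; apply: contraTneq lk => /eqP.
  by rewrite -/(dvdn _ _) pfactor_dvdn ?lt0n // -leqNgt.
exists k; split=> //; rewrite -lognM ?lt0n //.
have dvdxy j' : (j' <= k)%N -> (p ^ j' %| (x * y)%R k)%N = (p ^ j' %| x k * y k)%N.
  move=> jk'; rewrite residueM /dvdn modn_dvdm //.
  exact: dvdn_exp2l.
apply/eqP; rewrite eqn_leq; apply/andP; split.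
  by rewrite leqNgt -pfactor_dvdn ?lt0n // dvdxy // pfactor_dvdn ?lt0n // ltnn.
by rewrite -pfactor_dvdn ?lt0n // dvdxy ?(ltnW lk) // pfactor_dvdn ?lt0n.
Qed.

Fact padic_integral : GRing.integral_domain_axiom Zp.
Proof.
move=> x y xy0; apply: contraT; rewrite negb_or => /andP[x0 y0].
by have [k [_ _]] := residue_mul_neq0 x0 y0; rewrite xy0 residue0.
Qed.

HB.instance Definition _ :=
  GRing.ComUnitRing_isIntegral.Build Zp padic_integral.

Lemma vpM x y : vp (x * y) = (vp x + vp y)%E.
Proof.
have [->|x0] := eqVneq x 0.
  rewrite mul0r vp0; have [->|/vp_neq0[k _ ->]//] := eqVneq y 0; by rewrite vp0.
have [->|y0] := eqVneq y 0.
  by rewrite mulr0 vp0; have [k _ ->] := vp_neq0 x0.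
have [k [xk yk xyk Dxy]] := residue_mul_neq0 x0 y0.
by rewrite (vpE xk) (vpE yk) (vpE xyk) Dxy PoszD.
Qed.

End PadicRing.

Notation padic_field p_pr := {fraction (padic_int p_pr)}.

(** By [vpM] this does not depend on the chosen representative. *)
Definition vpQ (p : nat) (p_pr : prime p) (q : padic_field p_pr) : \bar int :=
  (vp \n_(repr q) - vp \d_(repr q))%E.

Lemma vpQ_tofrac (p : nat) (p_pr : prime p) (x : padic_int p_pr) :
  vpQ (tofrac x) = vp x.
Proof.
have d0 := denom_ratioP (repr (tofrac x)).
have E : vp \n_(repr (tofrac x)) = (vp x + vp \d_(repr (tofrac x)))%E.
  have := FracField.equivf_l (Ratio x 1).
  rewrite -vpM !numden_Ratio ?oner_neq0 // mulr1 mulrC.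
  have -> : (\pi_(FracField.type (padic_int p_pr)) (Ratio x 1) = tofrac x)%qT.
    by rewrite piE.
  by rewrite mulrC => ->; rewrite mulrC.
rewrite /vpQ E; have [k _ ->] := vp_neq0 d0.
have [->|/vp_neq0[l _ ->]] := eqVneq x 0; first by rewrite vp0.
by congr (_%:E); apply: addrK.
Qed.

Record algebraic_closure (K : fieldType) := AlgebraicClosure {
  closure_field :> closedFieldType;
  closure_embed : {rmorphism K -> closure_field};
  closure_algebraic : forall z, algebraicOver closure_embed z
}.

Section Discriminant.
Variables (K : fieldType) (Kbar : algebraic_closure K).
Local Notation iota := (closure_embed Kbar).

Definition roots_in_closure (h : {poly K}) : seq Kbar :=
  sval (closed_field_poly_normal (map_poly iota h)).

(** The leading coefficient is raised to [2 m - 1], not to the more usual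
    [2 m - 2], and linear polynomials have discriminant [1]. *)
Definition discriminant_in_closure (h : {poly K}) : Kbar :=
  let m := (size h).-1 in
  let r := roots_in_closure h in
  if m == 1%N then 1 else
  iota (lead_coef h) ^+ (2 * m - 1) *
    \prod_(i < m) \prod_(j < m | (i < j)%N) (r`_i - r`_j) ^+ 2.

(** The discriminant as an element of the base field; the choice is from a
    singleton by [discriminantE] and the injectivity of [iota]. *)
Definition discriminant (h : {poly K}) : K :=
  xget 0 [set d | iota d = discriminant_in_closure h]%classic.

Lemma roots_in_closureP (h : {poly K}) :
  map_poly iota h =
    iota (lead_coef h) *: \prod_(z <- roots_in_closure h) ('X - z%:P).
Proof.
by rewrite -lead_coef_map /roots_in_closure; case: closed_field_poly_normal.
Qed.

Lemma size_roots_in_closure (h : {poly K}) :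
  h != 0 -> size (roots_in_closure h) = (size h).-1.
Proof.
move=> h0; rewrite -(size_map_poly iota) roots_in_closureP size_scale.
  by rewrite size_prod_XsubC.
by rewrite fmorph_eq0 lead_coef_eq0.
Qed.

Lemma discriminantE (h : {poly K}) :
  iota (discriminant h) = discriminant_in_closure h.
Proof.
apply: (@xgetPex K 0 [set d | iota d = discriminant_in_closure h]%classic).
rewrite /discriminant_in_closure.
case: eqP => _; first by exists 1; rewrite /= rmorph1.
set n := (size h).-1; set r := roots_in_closure h.
suff [d dE] : exists d, iota d =
    \prod_(i < n) \prod_(j < n | (i < j)%N) (r`_i - r`_j) ^+ 2.
  by exists (lead_coef h ^+ (2 * n - 1) * d); rewrite /= rmorphM rmorphXn /= dE.
pose a : 'rV[Kbar]_n := \row_i r`_i.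
pose V := Vandermonde n a.
have -> : \prod_(i < n) \prod_(j < n | (i < j)%N) (r`_i - r`_j) ^+ 2 =
    (\det V) ^+ 2.
  rewrite det_Vandermonde -prodrXl; apply: eq_bigr => i _.
  by rewrite -prodrXl; apply: eq_bigr => j _; rewrite !mxE -sqrrN opprB.
have [V0|VU] := eqVneq (\det V) 0; first by exists 0; rewrite V0 expr0n rmorph0.
have h_root (j : 'I_n) : (map_poly iota h).[r`_j] = 0.
  have h0 : h != 0 by case: j; rewrite /n; case: eqP => // ->; rewrite size_poly0.
  apply/rootP; rewrite roots_in_closureP rootZ ?fmorph_eq0 ?lead_coef_eq0 //.
  by rewrite root_prod_XsubC mem_nth // size_roots_in_closure.
pose c l := - (h`_l / lead_coef h).
have rn (j : 'I_n) : r`_j ^+ n = \sum_(l < n) iota (c l) * r`_j ^+ l.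
  have szh : size h = n.+1 by rewrite prednK //; case: j; rewrite /n; case: size.
  have lc0 : lead_coef h != 0.
    by rewrite lead_coef_eq0 -size_poly_gt0 szh.
  have := h_root j; rewrite horner_coef size_map_poly szh big_ord_recr /=.
  rewrite [h in _ + _ = h -> _]/(0) => /eqP; rewrite addrC addr_eq0 => /eqP E.
  have lcE : (map_poly iota h)`_n = iota (lead_coef h) by rewrite coef_map lead_coefE.
  have lc0' : iota (lead_coef h) != 0 by rewrite fmorph_eq0.
  apply: (mulfI lc0'); rewrite -lcE E mulr_sumr -sumrN.
  apply: eq_bigr => l _; rewrite lcE coef_map /= /c rmorphN fmorph_div mulrA.
  by rewrite mulrN [iota (lead_coef h) * _]mulrC divfK // mulNr.
pose C : 'M[K]_n :=
  \matrix_(k, l) (if k.+1 == n then c l else ((l : nat) == k.+1)%:R).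
have CV : map_mx iota C *m V = V *m diag_mx a.
  apply/matrixP => k j; rewrite mul_mx_diag !mxE -exprSr.
  have [kn|kn] := eqVneq k.+1 n.
    rewrite kn rn; apply: eq_bigr => l _; by rewrite !mxE kn eqxx.
  have kltn : (k.+1 < n)%N by rewrite ltn_neqAle kn ltn_ord.
  rewrite (bigD1 (Ordinal kltn)) //= !mxE (negPf kn) eqxx rmorph1 mul1r.
  rewrite big1 ?addr0 // => l /negPf lk; rewrite !mxE (negPf kn).
  by rewrite -val_eqE /= in lk; rewrite lk rmorph0 mul0r.
have Vunit : V \in unitmx by rewrite unitmxE unitfE.
have powC k : map_mx iota (iter k (mulmx C) 1%:M) *m V =
    V *m diag_mx (\row_i (r`_i ^+ k)).
  elim: k => [|k IHk] /=.
    rewrite map_mx1 mul1mx (_ : diag_mx _ = 1%:M) ?mulmx1 //.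
    by apply/matrixP => i j; rewrite !mxE.
  rewrite map_mxM -mulmxA IHk mulmxA CV -mulmxA; congr (_ *m _).
  by apply/matrixP => i j; rewrite mul_diag_mx !mxE mulrnAr exprS.
exists (\det (\matrix_(i < n, j < n) \tr (iter (i + j) (mulmx C) 1%:M))).
have -> : (\det V) ^+ 2 = \det (V *m V^T) by rewrite det_mulmx det_tr expr2.
rewrite -det_map_mx; congr (\det _).
apply/matrixP => i j; rewrite !mxE /= -trace_map_mx.
have := powC (i + j)%N => /(congr1 (mulmx^~ (invmx V))).
rewrite mulmxK // => ->; rewrite mxtrace_mulC mulmxA mulVmx // mul1mx.
rewrite mxtrace_diag; apply: eq_bigr => l _; by rewrite !mxE exprD.
Qed.

End Discriminant.

(** Ring-theoretic notions in [R]: for [R := {poly padic_int p_pr}] a constant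
    associated to [p] is irreducible, so that polynomials with content divisible
    by [p] factor as well.  The library's [irreducible_poly], [coprimep] and
    [dvdp] describe factorization over the field of fractions instead. *)
Definition irreducible_elt (R : idomainType) (a : R) : Prop :=
  [/\ a != 0, a \isn't a GRing.unit &
    forall b c, a = b * c -> b \is a GRing.unit \/ c \is a GRing.unit].

Definition coprime_elt (R : idomainType) (a b : R) : Prop :=
  forall d, (exists a', a = d * a') -> (exists b', b = d * b') ->
  d \is a GRing.unit.

Section Factorization.
Variables (p : nat) (p_pr : prime p) (n m : nat).
Local Notation Zp := (padic_int p_pr).
Variables (alpha : 'I_n -> Zp) (g : 'I_m -> {poly Zp}).

(** As no [g j] has a root, [fact_eq] makes the [alpha i] all the roots of [F],
    with multiplicities [e i], and makes them coprime to the [g j]. *)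
Record padic_factorization (F : {poly Zp}) (e : 'I_n -> nat) (t : 'I_m -> nat) :
    Prop := PadicFactorization {
  fact_eq : exists2 u : Zp, u \is a GRing.unit &
    F = u *: (\prod_i ('X - (alpha i)%:P) ^+ e i * \prod_j g j ^+ t j);
  fact_alpha_inj : injective alpha;
  fact_e_gt0 : forall i, (0 < e i)%N;
  fact_t_gt0 : forall j, (0 < t j)%N;
  fact_irreducible : forall j, irreducible_elt (g j);
  fact_coprime : forall j k, j != k -> coprime_elt (g j) (g k);
  fact_no_root : forall j z, ~~ root (g j) z
}.

Definition radical : {poly Zp} :=
  \prod_i ('X - (alpha i)%:P) * \prod_j g j.

Definition Delta (Qpbar : algebraic_closure (padic_field p_pr)) : \bar int :=
  vpQ (discriminant Qpbar (map_poly (@tofrac Zp) radical)).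

End Factorization.

(* Main.v *)
Require Import Defs.
From HB Require Import structures.
From mathcomp Require Import all_boot all_order all_algebra.
From mathcomp Require Import zify ring.
From mathcomp Require Import boolp classical_sets constructive_ereal.

Set Implicit Arguments.
Unset Strict Implicit.
Unset Printing Implicit Defensive.

Import Order.TTheory GRing.Theory Num.Theory.
Local Open Scope ring_scope.

(** Write the radical as [h = (x - a) * q] with [a = alpha i].  The heart of the
    matter is that [q.[a] = h^`().[a]] divides the discriminant of [h] in [Z_p]
    as soon as [h] has degree at least [2].  Then [vp q.[a] <= Delta], so every
    factor [w] of [q] satisfies

      [vp w.[a] <= vp q.[a] <= Delta < vp (abar - a) <= vp (w.[abar] - w.[a])],

    and the ultrametric inequality gives [vp w.[abar] = vp w.[a]].  The factors
    [g j] and [x - alpha k], for [k != i], are of this kind, and [f_i] is a unit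
    times a product of powers of them.  If [h] is linear, then [q] and all its
    factors are constant and there is nothing to prove.

    With the normalization by [lead_coef h ^+ (2 * m - 1)], the discriminant of
    [h] of degree [m] is, up to sign, the resultant of [h] and [h^`()], that is
    [lead_coef h ^+ m.-1] times the product of the values of [h^`()] at the roots
    of [h].  The divisibility is then the quantitative form of the vanishing of
    the resultant of [h] and a second polynomial [w], here [h^`()], at a common
    root.  Both facts are read off a single [m] by [m] matrix with entries in the
    coefficient ring ([mulmod_mx]), a compact form of the Sylvester matrix: it
    describes the multiplication by [w] modulo [h], from a basis of suitable
    truncations of [h] to the basis of monomials. At a root [r] of [h] it sends
    the column of powers of [r] to [w.[r]] times the column of values of the
    truncations. Using all the roots at once gives its determinant
    ([det_mulmod_mx]); using the single root [a] and the adjugate shows that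
    [w.[a]] divides this determinant in the coefficient ring
    ([dvd_det_mulmod_mx]). *)

(** * The matrix of multiplication modulo a polynomial *)

(** The truncation [drop_poly (d - i') h] is [h / x ^ (d - i')] without its polar
    part; for [h] of degree [d.+1] it has degree [i'.+1] and leading coefficient
    [lead_coef h].  Unlike the powers of [x], these polynomials keep, when
    multiplied by a [w] of degree at most [d], a representative modulo [h] of
    degree at most [d] with coefficients in [R], even if [h] is not monic. *)
Definition mulmod_basis (R : nzRingType) (d : nat) (h : {poly R}) (i : nat) :
    {poly R} :=
  if i is i'.+1 then drop_poly (d - i') h else 1.

(** A representative, modulo [h], of [w * mulmod_basis d h i].  Subtracting this
    multiple of [h] brings the degree down to [d] without any division by the
    leading coefficient of [h]. *)
Definition mulmod_row (R : nzRingType) (d : nat) (h w : {poly R}) (i : nat) :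
    {poly R} :=
  if i is i'.+1 then w * drop_poly (d - i') h - h * drop_poly (d - i') w else w.

Definition mulmod_mx (R : nzRingType) (d : nat) (h w : {poly R}) : 'M[R]_d.+1 :=
  \matrix_(i, j) (mulmod_row d h w i)`_j.

(** As [drop_poly k u * 'X^k = u - take_poly k u], the terms [h * w] cancel after
    multiplication by ['X^k], and only products with polynomials of degree less
    than [k] remain. *)
Lemma size_bezout_drop (R : comNzRingType) (m k : nat) (h w : {poly R}) :
  (size h <= m.+1)%N -> (size w <= m)%N ->
  (size (w * drop_poly k h - h * drop_poly k w)%R <= m)%N.
Proof.
move=> szh szw; apply/leq_sizeP => j mj.
have E : (w * drop_poly k h - h * drop_poly k w) * 'X^k =
    h * take_poly k w - w * take_poly k h.
  have take (u : {poly R}) : take_poly k u = u - drop_poly k u * 'X^k.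
    by rewrite -{2}(poly_take_drop k u) addrK.
  by rewrite !take; ring.
have -> : (w * drop_poly k h - h * drop_poly k w)`_j =
    ((w * drop_poly k h - h * drop_poly k w) * 'X^k)`_(j + k).
  by rewrite coefMXn ltnNge leq_addl /= addnK.
rewrite E coefB.
have small (a b : {poly R}) : (size a <= m.+1)%N -> (a * take_poly k b)`_(j + k) = 0.
  move=> sza; have [->|_] := posnP k; first by rewrite take_poly0l mulr0 coef0.
  apply/(leq_sizeP _ (j + k)%N); last exact: leqnn.
  apply: leq_trans (size_polyMleq _ _) _.
  have := leq_add sza (size_take_poly k b) => le1.
  rewrite -ltnS; apply: leq_ltn_trans (_ : (m.+1 + k).-1 < _)%N; last first.
    by rewrite addSn /= ltnS leq_add2r.
  by rewrite -!subn1 leq_sub2r.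
by rewrite !small ?subr0 // leqW.
Qed.

Lemma mulmod_row_root (R : comNzRingType) (d : nat) (h w : {poly R}) (a : R) i :
  root h a -> (mulmod_row d h w i).[a] = w.[a] * (mulmod_basis d h i).[a].
Proof.
move=> /rootP ha; case: i => [|i] /=; first by rewrite hornerC mulr1.
by rewrite !hornerE ha mul0r subr0.
Qed.

Section MulmodMatrix.
Variables (R : comNzRingType) (d : nat) (h : {poly R}).
Hypothesis szh : size h = d.+2.

Lemma size_mulmod_basis i : (i <= d)%N -> (size (mulmod_basis d h i) <= i.+1)%N.
Proof.
case: i => [|i] id /=; first by rewrite size_poly1.
by rewrite size_drop_poly szh; lia.
Qed.

(** The matrix of coefficients is lower triangular, with diagonal
    [1, lead_coef h, ..., lead_coef h]. *)
Lemma det_mulmod_basis :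
  \det (\matrix_(i < d.+1, j < d.+1) (mulmod_basis d h i)`_j) = lead_coef h ^+ d.
Proof.
rewrite det_trig; last first.
  apply/is_trig_mxP => i j ij; rewrite mxE nth_default //.
  by apply: leq_trans (size_mulmod_basis _) ij; rewrite -ltnS.
rewrite big_ord_recl mxE /= coef1 mul1r.
under eq_bigr => i _.
  rewrite mxE /= coef_drop_poly (_ : (_ + _)%N = d.+1); last first.
    by case: i => i id /=; rewrite /bump /=; lia.
  over.
by rewrite prodr_const card_ord lead_coefE szh.
Qed.

Variable w : {poly R}.
Hypothesis szw : (size w <= d.+1)%N.

Lemma size_mulmod_row i : (size (mulmod_row d h w i) <= d.+1)%N.
Proof. by case: i => [|i] //=; apply: size_bezout_drop; rewrite ?szh. Qed.

Lemma mulmod_mx_root (a : R) : root h a ->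
  mulmod_mx d h w *m \col_(j < d.+1) a ^+ j =
  w.[a] *: \col_(i < d.+1) (mulmod_basis d h i).[a].
Proof.
move=> ha; apply/colP => i; rewrite !mxE -mulmod_row_root //.
rewrite (horner_coef_wide _ (size_mulmod_row i)).
by apply: eq_bigr => j _; rewrite !mxE.
Qed.

(** The adjugate turns [mulmod_mx_root] into [\det M *: v = w.[a] *: (\adj M *m u)],
    where the column [v] of powers of [a] has first entry [1]. *)
Lemma dvd_det_mulmod_mx (a : R) : root h a ->
  exists b, \det (mulmod_mx d h w) = w.[a] * b.
Proof.
move=> ha; pose v : 'cV[R]_d.+1 := \col_j a ^+ j.
pose u : 'cV[R]_d.+1 := \col_i (mulmod_basis d h i).[a].
exists ((\adj (mulmod_mx d h w) *m u) 0 0).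
have := congr1 (mulmx (\adj (mulmod_mx d h w))) (mulmod_mx_root ha).
rewrite mulmxA mul_adj_mx mul_scalar_mx -scalemxAr => /colP/(_ 0).
by rewrite !mxE expr0 mulr1.
Qed.

End MulmodMatrix.

(** Collecting [mulmod_mx_root] over all the roots gives [M *m V = T *m V *m D]
    with [V] a Vandermonde matrix, invertible as the roots are distinct, [T] the
    triangular matrix of [det_mulmod_basis] and [D] the diagonal matrix of the
    values of [w].  The determinant is thus, up to sign, the resultant of [h] and [w],
    with [w] taken in formal degree [d]. *)
Lemma det_mulmod_mx (K : fieldType) (d : nat) (h w : {poly K}) (r : seq K) :
  size h = d.+2 -> (size w <= d.+1)%N -> size r = d.+1 -> uniq r ->
  (forall z, z \in r -> root h z) ->
  \det (mulmod_mx d h w) = lead_coef h ^+ d * \prod_(i < d.+1) w.[r`_i].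
Proof.
move=> szh szw szr Ur hr.
have hri (i : 'I_d.+1) : root h r`_i by apply/hr/mem_nth; rewrite szr.
pose x : 'rV[K]_d.+1 := \row_i r`_i; pose V := Vandermonde d.+1 x.
have V0 : \det V != 0.
  rewrite det_Vandermonde; apply/prodf_neq0 => i _; apply/prodf_neq0 => j ij.
  by rewrite !mxE subr_eq0 nth_uniq ?szr // neq_ltn ij orbT.
pose T : 'M[K]_d.+1 := \matrix_(i, j) (mulmod_basis d h i)`_j.
have E : mulmod_mx d h w *m V = T *m V *m diag_mx (\row_i w.[r`_i]).
  rewrite mul_mx_diag; apply/matrixP => i k; rewrite !mxE.
  have /colP/(_ i) := mulmod_mx_root szh szw (hri k).
  rewrite !mxE => E; rewrite mulrC.
  have szb : (size (mulmod_basis d h i) <= d.+1)%N.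
    have id : (i <= d)%N by rewrite -ltnS.
    exact: leq_trans (size_mulmod_basis szh id) _.
  rewrite (horner_coef_wide _ szb) in E.
  transitivity (\sum_j mulmod_mx d h w i j * (\col_(j < d.+1) r`_k ^+ j) j 0).
    by apply: eq_bigr => j _; rewrite !mxE.
  by rewrite E; congr (_ * _); apply: eq_bigr => j _; rewrite !mxE.
apply: (mulIf V0); rewrite -det_mulmx E !det_mulmx det_mulmod_basis //.
rewrite det_diag mulrAC; congr (_ * _ * _).
by apply: eq_bigr => i _; rewrite mxE.
Qed.

Lemma map_mulmod_mx (R S : nzRingType) (f : {rmorphism R -> S}) d (h w : {poly R}) :
  map_mx f (mulmod_mx d h w) = mulmod_mx d (map_poly f h) (map_poly f w).
Proof.
have drop k u : map_poly f (drop_poly k u) = drop_poly k (map_poly f u).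
  by apply/polyP => i; rewrite !(coef_map, coef_drop_poly).
apply/matrixP => i j; rewrite !mxE -coef_map; congr (_`_ _).
by case: (i : nat) => [|k] //=; rewrite rmorphB !rmorphM /= !drop.
Qed.

(** * The discriminant and the derivative at a root *)

Lemma deriv_prod_XsubC (K : fieldType) (s : seq K) (i : nat) : (i < size s)%N ->
  (\prod_(z <- s) ('X - z%:P))^`().[s`_i] =
    \prod_(j < size s | j != i :> nat) (s`_i - s`_j).
Proof.
move=> si; rewrite (big_nth 0) big_mkord (bigD1 (Ordinal si)) //= derivM.
rewrite derivXsubC mul1r hornerD hornerM hornerXsubC subrr mul0r addr0.
by rewrite horner_prod; apply: eq_bigr => j _; rewrite hornerXsubC.
Qed.

(** The pairs below the diagonal contribute the same factors as those above, up to
    one sign each. *)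
Lemma prod_offdiag (R : comNzRingType) (n : nat) (F : 'I_n -> 'I_n -> R) :
  (forall i j, F j i = - F i j) ->
  exists k : nat, \prod_i \prod_(j | j != i) F i j =
   (-1) ^+ k * \prod_(i < n) \prod_(j < n | (i < j)%N) F i j ^+ 2.
Proof.
move=> antiF; exists (\sum_(i < n) \sum_(j < n | (i < j)%N) 1)%N.
have -> : \prod_i \prod_(j | j != i) F i j =
    (\prod_(i < n) \prod_(j < n | (i < j)%N) F i j) *
    (\prod_(i < n) \prod_(j < n | (j < i)%N) F i j).
  rewrite -big_split; apply: eq_bigr => i _ /=.
  rewrite (bigID (fun j : 'I_n => (i < j)%N)) /=; congr (_ * _).
    by apply: eq_bigl => j; rewrite -val_eqE neq_ltn /=; case: ltngtP.
  by apply: eq_bigl => j; rewrite -val_eqE neq_ltn /=; case: ltngtP.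
rewrite [X in _ * X](exchange_big_dep xpredT) //= -big_split -prodrXr -big_split.
apply: eq_bigr => i _ /=; rewrite -prodrXr -!big_split; apply: eq_bigr => j _ /=.
by rewrite (antiF i j) mulrN expr1 mulN1r expr2.
Qed.

(** Each [h^`().[r`_i]] is [lead_coef h] times the product of the other differences
    [r`_i - r`_j]; this accounts for the exponent [d + d.+1 = 2 * d.+1 - 1]. *)
Lemma prod_deriv_roots (K : fieldType) (d : nat) (h : {poly K}) (r : seq K) :
  size r = d.+1 -> h = lead_coef h *: \prod_(z <- r) ('X - z%:P) ->
  exists k : nat, lead_coef h ^+ d * \prod_(i < d.+1) (h^`()).[r`_i] =
    (-1) ^+ k * (lead_coef h ^+ (2 * d.+1 - 1) *
      \prod_(i < d.+1) \prod_(j < d.+1 | (i < j)%N) (r`_i - r`_j) ^+ 2).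
Proof.
move=> szr Eh; pose F (i j : 'I_d.+1) := r`_i - r`_j.
have [|k Ek] := prod_offdiag (F := F); first by move=> i j; rewrite /F opprB.
exists k; rewrite mulrCA -Ek.
have -> : \prod_(i < d.+1) (h^`()).[r`_i] =
    \prod_(i < d.+1) (lead_coef h * \prod_(j | j != i) F i j).
  by apply: eq_bigr => i _; rewrite {1}Eh derivZ hornerZ deriv_prod_XsubC ?szr.
rewrite big_split /= prodr_const card_ord mulrA -exprD.
by congr (_ ^+ _ * _); lia.
Qed.

(** The derivative at a root divides the discriminant over any integral domain.
    The bound on the size excludes the linear polynomials, whose discriminant is
    [1] by convention while the derivative is the leading coefficient. *)
Lemma discriminant_dvd_deriv (R : idomainType)
    (Kbar : algebraic_closure {fraction R}) (h : {poly R}) (a : R) :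
  (2 < size h)%N -> root h a ->
  exists b, discriminant Kbar (map_poly (@tofrac R) h) = tofrac (h^`().[a] * b).
Proof.
move=> h_gt2 ha; set H := map_poly _ h.
have [d szh d_gt0] : exists2 d, size h = d.+2 & (0 < d)%N.
  by exists (size h).-2; lia.
have tofrac_inj : injective (@tofrac R).
  by move=> x y /eqP; rewrite tofrac_eq => /eqP.
have szH : size H = d.+2 by rewrite size_map_inj_poly ?tofrac0.
have H0 : H != 0 by rewrite -size_poly_gt0 szH.
pose iota := closure_embed Kbar; set r := roots_in_closure Kbar H.
have szr : size r = d.+1 by rewrite size_roots_in_closure // szH.
pose Hbar := map_poly iota H.
have szHbar : size Hbar = d.+2 by rewrite size_map_poly.
have lcHbar : lead_coef Hbar = iota (lead_coef H) by rewrite lead_coef_map.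
have EHbar : Hbar = lead_coef Hbar *: \prod_(z <- r) ('X - z%:P).
  by rewrite lcHbar -roots_in_closureP.
have ED : iota (discriminant Kbar H) = lead_coef Hbar ^+ (2 * d.+1 - 1) *
    \prod_(i < d.+1) \prod_(j < d.+1 | (i < j)%N) (r`_i - r`_j) ^+ 2.
  rewrite discriminantE /discriminant_in_closure szH /= lcHbar.
  by case: eqP d_gt0 => // -[->].
have [Ur|] := boolP (uniq r); last first.
  (* A repeated root makes the discriminant vanish. *)
  case/(uniqPn 0) => k [l [kl]]; rewrite szr => ld Ekl; exists 0.
  apply: (fmorph_inj iota); rewrite mulr0 tofrac0 rmorph0 ED.
  apply/eqP; rewrite mulf_eq0; apply/orP; right.
  apply/prodf_eq0; exists (Ordinal (ltn_trans kl ld)) => //.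
  apply/prodf_eq0; exists (Ordinal ld) => //.
  by rewrite /= Ekl subrr expr0n.
have szh' : (size h^`() <= d.+1)%N.
  by rewrite -ltnS -szh lt_size_deriv // -size_poly_gt0 szh.
have [b Eb] := dvd_det_mulmod_mx szh szh' ha.
have szH' : (size Hbar^`() <= d.+1)%N.
  by rewrite -ltnS -szHbar lt_size_deriv // -size_poly_gt0 szHbar.
have hr z : z \in r -> root Hbar z.
  move=> zr; rewrite EHbar rootZ ?root_prod_XsubC //.
  by rewrite lead_coef_eq0 -size_poly_gt0 szHbar.
have Edet := det_mulmod_mx szHbar szH' szr Ur hr.
have [k Ek] := prod_deriv_roots szr EHbar.
exists ((-1) ^+ k * b); apply: (fmorph_inj iota); rewrite mulrCA -Eb.
rewrite rmorphM /= rmorphXn rmorphN1 rmorphM rmorphXn rmorphN1 /=.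
rewrite -[tofrac (\det _)]det_map_mx -det_map_mx !map_mulmod_mx -!deriv_map.
by rewrite -/H -/Hbar Edet Ek ED mulrA -exprMn mulrN1 opprK expr1n mul1r.
Qed.

(** * Valuations near a root *)

Section PadicValuation.
Variables (p : nat) (p_pr : prime p).
Implicit Types x y : padic_int p_pr.

Lemma vp_ge0 x : (0 <= vp x)%E.
Proof.
have [->|/vp_neq0[k _ ->]] := eqVneq x 0; first by rewrite vp0.
by rewrite lee_fin.
Qed.

Lemma vpMl_le x y : (vp x <= vp (x * y)%R)%E.
Proof. by rewrite vpM leeDl // vp_ge0. Qed.

(** If [vp x = l < vp y], then [y] vanishes modulo [p ^ l.+1] and [x] does not, so
    [x] and [x + y] have the same nonzero residue modulo [p ^ l.+1]. *)
Lemma vp_add_lt x y : (vp x < vp y)%E -> vp (x + y) = vp x.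
Proof.
have [->|/vp_neq0[k xk Ex]] := eqVneq x 0; first by rewrite vp0 ltNge leey.
set l := logn p (x k) in Ex *; rewrite Ex => lty.
have lk : (l.+1 <= k)%N.
  by rewrite ltnNge -pfactor_dvdn ?lt0n // /dvdn residue_mod.
have xl : x l.+1 != 0%N.
  rewrite (residue_le x lk) -/(dvdn _ _) pfactor_dvdn ?lt0n //.
  by rewrite -ltnNge.
have yl : y l.+1 = 0%N.
  apply/eqP; apply: contraTT lty => yl; rewrite (vpE yl) lte_fin.
  rewrite -leNgt; change (logn p (y l.+1) <= l)%N.
  by rewrite -ltnS ltnNge -pfactor_dvdn ?lt0n // /dvdn residue_mod.
have xyl : (x + y) l.+1 = x l.+1.
  by rewrite -[LHS]/((x l.+1 + y l.+1) %% p ^ l.+1)%N yl addn0 residue_mod.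
by rewrite -Ex (@vpE _ _ (x + y) l.+1) xyl // -vpE.
Qed.

(** The difference [w.[y] - w.[x]] is a multiple of [y - x]. *)
Lemma vp_horner_near (w : {poly padic_int p_pr}) x y :
  (vp w.[x] < vp (y - x)%R)%E -> vp w.[y] = vp w.[x].
Proof.
move=> near; rewrite -[w.[y]](subrK w.[x]) addrC; apply: vp_add_lt.
apply: lt_le_trans near _.
have /factor_theorem[q Eq] : root (w - w.[x]%:P) x.
  by rewrite /root !hornerE subrr.
have := congr1 (horner^~ y) Eq; rewrite /= !hornerE => ->.
by rewrite mulrC vpMl_le.
Qed.

End PadicValuation.

Section NearRoot.
Variables (p : nat) (p_pr : prime p) (Qpbar : algebraic_closure (padic_field p_pr)).
Local Notation Zp := (padic_int p_pr).
Variables (h : {poly Zp}) (a b : Zp).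
Hypotheses (ha : root h a) (h0 : h != 0).
Hypothesis near :
  (vpQ (discriminant Qpbar (map_poly (@tofrac Zp) h)) < vp (b - a)%R)%E.

(** For [h] of degree at least [2], [w.[a]] divides [h^`().[a]], hence the
    discriminant; for [h] linear, [w] is constant. *)
Lemma vp_cofactor_near (w s : {poly Zp}) :
  h = ('X - a%:P) * (w * s) -> vp w.[b] = vp w.[a].
Proof.
move=> Eh; have [h_gt2|h_le2] := ltnP 2 (size h).
  have [c Ec] := discriminant_dvd_deriv Qpbar h_gt2 ha.
  apply: vp_horner_near; apply: le_lt_trans near.
  rewrite Ec vpQ_tofrac Eh derivM derivXsubC !hornerE subrr mul0r addr0.
  by rewrite -mulrA vpMl_le.
suff /size_poly1P[c _ ->] : size w == 1%N by rewrite !hornerC.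
move: h0 h_le2; rewrite Eh !mulf_eq0 !negb_or polyXsubC_eq0 /= => /andP[w0 s0].
have szX : size ('X - a%:P) = 2%N := size_XsubC a.
rewrite size_monicM ?monicXsubC ?mulf_neq0 // szX size_mul //.
by move: w0 s0; rewrite -!size_poly_gt0; move: (size w) (size s) => x y; lia.
Qed.

End NearRoot.

Theorem lemma14 (p : nat) (p_pr : prime p)
    (Qpbar : algebraic_closure (padic_field p_pr))
    (f : {poly int}) (n m : nat)
    (alpha : 'I_n -> padic_int p_pr) (e : 'I_n -> nat)
    (g : 'I_m -> {poly padic_int p_pr}) (t : 'I_m -> nat)
    (f_fact : padic_factorization alpha g (map_poly intr f) e t)
    (i : 'I_n) (abar : padic_int p_pr)
    (abar_close : (Delta alpha g Qpbar < vp (abar - alpha i)%R)%E) :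
  let f_i : {poly padic_int p_pr} :=
    map_poly intr f %/ ('X - (alpha i)%:P) ^+ e i in
  (forall j : 'I_m, vp (g j).[abar] = vp (g j).[alpha i]) /\
  vp f_i.[abar] = vp f_i.[alpha i].
Proof.
move=> f_i; pose q := \prod_(k | k != i) ('X - (alpha k)%:P) * \prod_j g j.
have Eh : radical alpha g = ('X - (alpha i)%:P) * q.
  by rewrite /radical (bigD1 i) //= -mulrA.
have g0 j : g j != 0 by case: (fact_irreducible f_fact j).
have h0 : radical alpha g != 0.
  by rewrite mulf_neq0 //; apply/prodf_neq0 => k _; rewrite ?polyXsubC_eq0.
have hi : root (radical alpha g) (alpha i).
  by rewrite Eh rootM root_XsubC eqxx.
have same w s : q = w * s -> vp w.[abar] = vp w.[alpha i].
  by move=> Eq; apply: (vp_cofactor_near hi h0 abar_close (s := s)); rewrite -Eq.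
have same_g j : vp (g j).[abar] = vp (g j).[alpha i].
  by eapply same; rewrite /q (bigD1 j) //= mulrCA.
have same_alpha k : k != i ->
    vp ('X - (alpha k)%:P).[abar] = vp ('X - (alpha k)%:P).[alpha i].
  by move=> ki; eapply same; rewrite /q (bigD1 k ki) /= -mulrA.
split=> //; have [u _ Ef] := fact_eq f_fact.
have -> : f_i = u%:P * (\prod_(k | k != i) ('X - (alpha k)%:P) ^+ e k *
    \prod_j g j ^+ t j).
  rewrite /f_i Ef (bigD1 i) //= -mulrA -mul_polyC mulrCA mulrC.
  by rewrite Pdiv.IdomainMonic.mulpK // monic_exp ?monicXsubC.
(* Being insensitive to the passage from [alpha i] to [abar] is multiplicative. *)
pose P (w : {poly padic_int p_pr}) := vp w.[abar] = vp w.[alpha i].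
have PM v w : P v -> P w -> P (v * w).
  by rewrite /P !hornerM !vpM => -> ->.
have P1 : P 1 by rewrite /P !hornerC.
have PX w k : P w -> P (w ^+ k).
  by move=> Pw; elim: k => [|k IHk] //; rewrite exprS; apply/PM.
rewrite -/(P _); apply/PM; first by rewrite /P !hornerC.
apply/PM; apply: (big_ind P P1 PM) => k ki; apply/PX; first exact: same_alpha.
exact: same_g.
Qed.
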